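(* Let $n \ge 4$ and let $f : [1,\infty) \to \mathbb{R}$ be a convex function. Then for every unicyclic graph $G$ with $n$ vertices, $$ n f(2) \le I_f(G) \le f(n-1) + 2 f(2) + (n-3) f(1), $$ and both inequalities are attained (i.e., for each such $n$ and $f$, each of the two bounds is equal to $I_f(G)$ for some unicyclic graph $G$ with $n$ vertices).
   Context: All graphs are finite, connected, simple (no loops, no multiple edges) and have at least one edge. A unicyclic graph is a graph containing exactly one cycle. For a vertex $u$ of $G$, $d_u$ denotes its degree. For a function $f:[1,\infty)\to\mathbb{R}$, $I_f(G) = \sum_{u\in V(G)} f(d_u)$. *)

(* Defs.v *)
From mathcomp Require Import all_boot all_order all_algebra.
From mathcomp Require Import all_classical reals convex.

Set Implicit Arguments.
Unset Strict Implicit.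
Unset Printing Implicit Defensive.

Import Order.TTheory GRing.Theory Num.Theory.

Local Open Scope ring_scope.

(* Finite, connected, simple graphs with at least one edge, on the vertex
   type T. *)
Record graph (T : finType) : Type := Graph {
  adj :> rel T;
  adj_sym : symmetric adj;
  adj_irr : irreflexive adj;
  adj_connected : forall x y : T, connect adj x y;
  adj_edge : exists x y : T, adj x y
}.

Definition degree (T : finType) (G : graph T) (u : T) : nat :=
  #|[set v | adj G u v]|.

Definition cycle_edges (T : finType) (c : seq T) : {set {set T}} :=
  [set [set x; next c x] | x in c].

(* A cycle of G is a subgraph, not a closed walk: it is identified with its
   edge set, so that the choice of a starting point or of an orientation does
   not matter.  The condition on the size excludes [::] and the closed walks
   x, y, x along a single edge, which satisfy ucycle. *)
Definition is_cycle (T : finType) (G : graph T) (C : {set {set T}}) : Prop :=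
  exists c : seq T,
    [/\ (2 < size c)%N, ucycle (adj G) c & C = cycle_edges c].

Definition unicyclic (T : finType) (G : graph T) : Prop :=
  exists! C : {set {set T}}, is_cycle G C.

(* Every degree is at least 1 in a connected graph with an edge, so the sum
   depends only on the values of f on [1, +oo[. *)
Definition deg_index (R : realType) (f : R -> R) (T : finType) (G : graph T) :
    R :=
  \sum_(u : T) f (degree G u)%:R.

(* Main.v *)
(* A spanning tree rooted at r is given by a parent map strictly decreasing the
   distance to r.  Each non-tree edge closes a cycle with tree edges, and
   different non-tree edges give different cycles, while no cycle avoids the
   non-tree edges; hence a unicyclic graph has exactly one non-tree edge and its
   degrees sum to 2n.  The lower bound then follows from the line through
   (1, f 1) and (2, f 2), which supports f on the integers.  For the upper bound
   let m be the slope of f between 2 and n - 1: f d <= f 2 + m (d - 2) for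
   2 <= d <= n - 1, f 2 <= f 1 + m, and at least three vertices have degree at
   least 2.  Both bounds are attained on a cycle of length k with n - k pendant
   vertices attached to one of its vertices, for k = n and k = 3. *)
Require Import Defs.
From mathcomp Require Import all_boot all_order all_algebra.
From mathcomp Require Import all_classical reals convex.
From mathcomp Require Import interval_inference.
From mathcomp Require Import zify ring lra.

Set Implicit Arguments.
Unset Strict Implicit.
Unset Printing Implicit Defensive.

Import Order.TTheory GRing.Theory Num.Theory.

(** * Neighbours on a simple cycle *)

Section Cycles.
Variable T : finType.
Implicit Types (x y : T) (c : seq T) (e : rel T).

Lemma set2_inj (a b x y : T) :
  [set a; b] = [set x; y] -> (a = x /\ b = y) \/ (a = y /\ b = x).
Proof.
move=> E.
have : (x \in [set a; b]) && (y \in [set a; b]) by rewrite E set21 set22.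
have : (a \in [set x; y]) && (b \in [set x; y]) by rewrite -E set21 set22.
rewrite !in_set2 => /andP[/orP[]/eqP-> /orP[]/eqP->]; rewrite ?orbb; auto.
  by case/andP=> _ /eqP->; left.
by case/andP=> /eqP-> _; left.
Qed.

Lemma next_last x c : uniq (x :: c) -> next (x :: c) (last x c) = x.
Proof.
(* The last element has index [size c] in [x :: c], one past the end of [c], so [nth] returns its
   default, the head [x]. *)
by move=> U; rewrite next_nth mem_last index_last // nth_default.
Qed.

(** With [x] rotated to the front, its successor is the second entry and its predecessor the last
    one; these differ from length three on. *)
Lemma next_neq_prev c x :
  uniq c -> 2 < size c -> x \in c -> next c x != prev c x.
Proof.
move=> Uc sc xc; have [i s def_c] := rot_to xc.
rewrite -(next_rot i Uc) -(prev_rot i Uc) def_c.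
have Us : uniq (x :: s) by rewrite -def_c rot_uniq.
have : 2 < size (x :: s) by rewrite -def_c size_rot.
have -> : prev (x :: s) x = last x s by rewrite -{2}(next_last Us) prev_next.
case: s {def_c} Us => [|y [|z s]] //=; rewrite eqxx.
case/and3P=> _ ys _ _; rewrite eq_sym.
by apply: contraNneq ys => <-; apply: mem_last.
Qed.

End Cycles.

(** * Spanning trees and fundamental cycles *)

Section Tree.
Variables (T : finType) (G : graph T).
Implicit Types (r x y u v : T) (h : T -> nat) (p : T -> T).

(** [h] is the distance from [r]; the last but one vertex of a shortest path to [v] is a neighbour
    of smaller distance. *)
Lemma closer_neighbour r : exists (h : T -> nat) (p : T -> T),
  forall v, v != r -> adj G v (p v) /\ h (p v) < h v.
Proof.
have ex v : exists n,
    `[< exists q, [/\ path (adj G) r q, last r q = v & size q = n] >].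
  have /connectP[q rq ->] := adj_connected G r v.
  by exists (size q); apply/asboolP; exists q.
pose h v := ex_minn (ex v).
have hP v : v != r -> exists u, adj G v u && (h u < h v).
  rewrite {2}/h; case: ex_minnP => n /asboolP[q [rq lq <-]] _.
  case/lastP: q rq lq => [_ /= -> |q w]; first by rewrite eqxx.
  rewrite rcons_path last_rcons size_rcons => /andP[rq qw] <-.
  exists (last r q); rewrite adj_sym qw ltnS /h.
  by case: ex_minnP => m _; apply; apply/asboolP; exists q.
exists h, (fun v => odflt r [pick u | adj G v u && (h u < h v)]) => v vr.
case: pickP => [u /andP[]//|none]; have [u] := hP v vr.
by rewrite none.
Qed.

(** The guards keep the value [p r] from creating an edge. *)
Definition tree_rel r p : rel T :=
  fun u v => (u != r) && (v == p u) || (v != r) && (u == p v).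

Lemma tree_rel_sym r p : symmetric (tree_rel r p).
Proof. by move=> u v; rewrite /tree_rel orbC. Qed.

Variables (r : T) (h : T -> nat) (p : T -> T).
Hypothesis hp : forall v, v != r -> adj G v (p v) /\ h (p v) < h v.
Let t := tree_rel r p.

Lemma tree_rel_sub : subrel t (adj G).
Proof.
move=> u v /orP[]/andP[nr /eqP->]; first by case: (hp nr).
by rewrite adj_sym; case: (hp nr).
Qed.

Lemma tree_rel_connected u v : connect t u v.
Proof.
have csym : connect_sym t by apply: sym_connect_sym; apply: tree_rel_sym.
suff root w : connect t w r by apply: connect_trans (root u) _; rewrite csym.
have [n] := ubnP (h w); elim: n w => // n IHn w; rewrite ltnS => hw.
have [->//|nr] := eqVneq w r.
apply: (@connect_trans _ _ (p w)).
  by apply: connect1; rewrite /t /tree_rel nr eqxx.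
by apply: IHn; apply: leq_trans hw; case: (hp nr).
Qed.

(** Each edge counts as two ordered pairs: [D] collects the arcs from child to parent, [U] their
    reversals. As [h] falls along [D] and rises along [U], the two are disjoint. *)
Lemma card_tree_rel : #|[set a | t a.1 a.2]| = #|T|.-1.*2.
Proof.
pose D := [set (v, p v) | v in [set~ r]].
pose U := [set (p v, v) | v in [set~ r]].
have -> : [set a | t a.1 a.2] = D :|: U.
  apply/setP=> -[u v]; rewrite !inE /= /t /tree_rel; congr (_ || _).
    apply/andP/imsetP => [[nr /eqP->]|[w]]; first by exists u; rewrite ?inE.
    by rewrite !inE => nr [-> ->].
  apply/andP/imsetP => [[nr /eqP->]|[w]]; first by exists v; rewrite ?inE.
  by rewrite !inE => nr [-> ->].
have dis : D :&: U = finset.set0.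
  apply/setP=> a; rewrite !inE; apply/negP=> /andP[].
  case/imsetP=> v; rewrite !inE => vr -> /imsetP[w]; rewrite !inE => wr [e1 e2].
  have [_ h1] := hp vr; have [_ h2] := hp wr.
  by move: h1 h2; rewrite e2 -e1 => hwv /(ltn_trans hwv); rewrite ltnn.
rewrite cardsU dis cards0 subn0 !card_imset => [|v w []//|v w []//].
by rewrite addnn cardsC1.
Qed.

(* Both cycle neighbours of a cycle vertex of maximal height would have to be
   its parent. *)
Lemma tree_rel_acyclic c : 2 < size c -> ucycle (adj G) c ->
  exists2 x, x \in c & ~~ t x (next c x).
Proof.
move=> sc /andP[cc uc]; apply/hasP/negPn/negP => /hasPn /= no.
have ct : cycle t c.
  by apply: cycle_from_next => // x xc; apply/negPn/no.
have [x0 x0c] : exists x, x \in c.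
  by case: (c) sc => // x s _; exists x; rewrite mem_head.
case: (@arg_maxnP _ x0 [in c] h x0c) => x xc hx.
have par y : y \in c -> t x y -> y = p x.
  move=> yc /orP[]/andP[nr /eqP]// xy; have [_] := hp nr.
  by rewrite -xy ltnNge; have /= -> := hx y yc.
have := next_neq_prev uc sc xc.
rewrite (par (next c x)) ?mem_next ?next_cycle //.
rewrite (par (prev c x)) ?mem_prev ?eqxx // /t tree_rel_sym.
exact: prev_cycle.
Qed.

End Tree.

(** A path in [t] from [x] to [y] without repetitions is closed by the edge [xy]. The last clause,
    that no other edge leaves [t], tells the cycles of different non-tree edges apart. *)
Lemma fundamental_cycle (T : finType) (G : graph T) (t : rel T) x y :
  subrel t (adj G) -> connect t x y -> adj G x y -> ~~ t x y ->
  exists C, [/\ is_cycle G C, [set x; y] \in C &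
    forall A, A \in C -> A = [set x; y] \/ exists u v, A = [set u; v] /\ t u v].
Proof.
move=> tG /connectP[q0 xq0 ly] xy nt.
case: (shortenP xq0) ly => q xq uq _ ly {q0 xq0}.
have nx : next (x :: q) y = x by rewrite ly next_last.
exists (cycle_edges (x :: q)); split.
- exists (x :: q); split=> //.
    (* Fewer than three vertices would mean a loop at [x] or the single arc [t x y]. *)
    case: q xq ly nt {uq nx} => [|z [|w q]] //=.
      by move=> _ eyx; rewrite eyx adj_irr in xy.
    by rewrite andbT => xz ->; rewrite xz.
  rewrite /ucycle uq andbT /= rcons_path -ly adj_sym xy andbT.
  exact: sub_path xq.
- apply/imsetP; exists y; first by rewrite ly mem_last.
  by rewrite nx finset.setUC.
- move=> A /imsetP[u uc ->].
  pose t' u v := t u v || ((u == y) && (v == x)).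
  have : cycle t' (x :: q).
    rewrite /= rcons_path -ly {2}/t' !eqxx orbT andbT.
    by apply: sub_path xq => a b; rewrite /t' => ->.
  move=> /next_cycle/(_ uc)/orP[tu|/andP[/eqP-> /eqP->]].
    by right; exists u, (next (x :: q) u).
  by left; rewrite finset.setUC.
Qed.

(** * The degree sum of a unicyclic graph *)

Lemma sum_degree (T : finType) (G : graph T) :
  \sum_u degree G u = #|[set a | adj G a.1 a.2]|.
Proof.
under eq_bigr do rewrite /degree -sum1dep_card.
by rewrite pair_big_dep /= sum1dep_card.
Qed.

Lemma unicyclic_sum_degree (T : finType) (G : graph T) :
  unicyclic G -> \sum_u degree G u = #|T|.*2.
Proof.
case=> C0 [[c [sc uc _]] uniC].
have [r r_c] : exists x, x \in c.
  by case: (c) sc => // x s _; exists x; rewrite mem_head.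
have [h [p hp]] := closer_neighbour G r.
pose t := tree_rel r p.
have tG : subrel t (adj G) := tree_rel_sub hp.
have [x xc nt] := tree_rel_acyclic hp sc uc.
have /andP[cc _] := uc.
have := next_cycle cc xc; set y := next c x in nt * => xy.
have [C [CG xyC Cxy]] := fundamental_cycle tG (tree_rel_connected hp x y) xy nt.
rewrite sum_degree -(cardsID [set a | t a.1 a.2]).
have -> : [set a | adj G a.1 a.2] :&: [set a | t a.1 a.2] = [set a | t a.1 a.2].
  by apply/finset.setIidPr/fintype.subsetP=> a; rewrite !inE; apply: tG.
(* The fundamental cycle of any non-tree edge [uv] is the unique cycle, whose only edge outside the
   tree is [xy]. *)
have -> : [set a | adj G a.1 a.2] :\: [set a | t a.1 a.2] = [set (x, y); (y, x)].
  apply/setP=> -[u v]; rewrite !inE /= !xpair_eqE.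
  apply/andP/orP => [[ntuv uv]|[]/andP[/eqP-> /eqP->]]; last first.
  - by rewrite /t tree_rel_sym adj_sym.
  - by [].
  have [C' [CG' uvC _]] :=
    fundamental_cycle tG (tree_rel_connected hp u v) uv ntuv.
  move: uvC; rewrite -(uniC _ CG') (uniC _ CG) => /Cxy[E|[a [b [E tab]]]].
    by case: (set2_inj E) => -[-> ->]; rewrite !eqxx; auto.
  case: (set2_inj E) ntuv => -[-> ->]; first by rewrite tab.
  by rewrite /t tree_rel_sym -/t tab.
rewrite (card_tree_rel hp) cards2 xpair_eqE.
have -> : (x == y) = false by apply: contraTF xy => /eqP <-; rewrite adj_irr.
by have : 0 < #|T| by [apply/card_gt0P; exists x]; lia.
Qed.

(** * Degree bounds and degrees on a cycle *)

Section Degree.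
Variables (T : finType) (G : graph T).
Implicit Types (x y a b : T) (c : seq T).

Lemma degree_gt0 x : 0 < degree G x.
Proof.
have [u [v uv]] := adj_edge G.
have [y /eqP yx] : exists y, y != x.
  have [E|] := eqVneq u x; last by exists u.
  by exists v; apply: contraTneq uv => ->; rewrite E adj_irr.
have /connectP[[_ /yx//|z q /= /andP[xz _] _]] := adj_connected G x y.
by apply/card_gt0P; exists z; rewrite inE.
Qed.

Lemma degree_lt x : degree G x < #|T|.
Proof.
rewrite -[#|T|]prednK; last by apply/card_gt0P; exists x.
rewrite ltnS -(cardsC1 x); apply: subset_leq_card; apply/fintype.subsetP=> y.
by rewrite !inE; apply: contraTneq => ->; rewrite adj_irr.
Qed.

Variables (c : seq T).
Hypotheses (sc : 2 < size c) (ucc : ucycle (adj G) c).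

Let cc : cycle (adj G) c. Proof. by case/andP: ucc. Qed.
Let uc : uniq c. Proof. by case/andP: ucc. Qed.

Lemma cycle_degree x : x \in c -> 1 < degree G x.
Proof.
move=> xc; have := next_neq_prev uc sc xc => np.
have -> : 2 = #|[set next c x; prev c x]| by rewrite cards2 np.
apply: subset_leq_card; apply/fintype.subsetP=> y.
rewrite !inE => /orP[]/eqP->; first exact: next_cycle.
by rewrite adj_sym prev_cycle.
Qed.

(** The two neighbours on the cycle are distinct, so both candidates are used. With [a = b] this is
    contradictory, which keeps pendant vertices off cycles. *)
Lemma cycle_two_neighbours x a b : x \in c ->
    (forall y, y \in c -> adj G x y -> y = a \/ y = b) ->
  (next c x = a /\ prev c x = b) \/ (next c x = b /\ prev c x = a).
Proof.
move=> xc nb; have /eqP np := next_neq_prev uc sc xc.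
have := nb (next c x); rewrite mem_next next_cycle // => /(_ xc isT).
have := nb (prev c x); rewrite mem_prev adj_sym prev_cycle // => /(_ xc isT).
by case=> pE [] nE; [case: np; congruence|right|left|case: np; congruence].
Qed.

End Degree.

Lemma card_degree_gt1 (T : finType) (G : graph T) :
  unicyclic G -> 2 < #|[set u | 1 < degree G u]|.
Proof.
case=> C [[c [sc ucc _]] _]; apply: (leq_trans sc).
have /andP[_ uc] := ucc; rewrite -(card_uniqP uc); apply: subset_leq_card.
by apply/fintype.subsetP=> x xc; rewrite inE (cycle_degree sc ucc).
Qed.

(** * The extremal graphs: a cycle with pendant vertices at 0 *)

Section Lollipop.
Variables n k : nat.
Hypotheses (k2 : 2 < k) (kn : k <= n.+1).
Implicit Types i j : 'I_n.+1.

(* The cycle is 0, ..., k - 1; the vertices k, ..., n are attached to 0. *)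
Definition lollipop_arc (i j : nat) :=
  (j < k) && (j == i.+1) || (i == 0) && (k.-1 <= j).

Definition lollipop_adj : rel 'I_n.+1 :=
  fun i j => lollipop_arc i j || lollipop_arc j i.

Lemma lollipop_sym : symmetric lollipop_adj.
Proof. by move=> i j; rewrite /lollipop_adj orbC. Qed.

Lemma lollipop_irr : irreflexive lollipop_adj.
Proof. by move=> i; rewrite /lollipop_adj /lollipop_arc; lia. Qed.

Lemma lollipop_connected i j : connect lollipop_adj i j.
Proof.
have csym : connect_sym lollipop_adj := sym_connect_sym lollipop_sym.
suff root i' : connect lollipop_adj i' ord0.
  by apply: connect_trans (root i) _; rewrite csym.
have [m] := ubnP (i' : nat); elim: m i' => // m IHm i'; rewrite ltnS => im.
(* From [k.-1] on every vertex is adjacent to 0: [k.-1] by the edge closing the cycle, the others as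
   pendant vertices. *)
have [lt|ge] := ltnP i' k.-1; last first.
  by apply: connect1; rewrite /lollipop_adj /lollipop_arc /=; lia.
have [->|i0] := eqVneq i' ord0; first exact: connect0.
have iE : (inord i'.-1 : 'I_n.+1) = i'.-1 :> nat.
  by rewrite inordK //; have := ltn_ord i'; lia.
have {}i0 : (i' : nat) != 0 by [].
apply: (@connect_trans _ _ (inord i'.-1)).
  by apply: connect1; rewrite /lollipop_adj /lollipop_arc iE; lia.
by apply: IHm; rewrite iE; lia.
Qed.

Lemma lollipop_edge : exists i j, lollipop_adj i j.
Proof.
exists ord0, ord_max; rewrite /lollipop_adj /lollipop_arc /=; lia.
Qed.

Definition lollipop : graph 'I_n.+1 :=
  Graph lollipop_sym lollipop_irr lollipop_connected lollipop_edge.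

(** The rotation of the rim 0, ..., k - 1, followed by its inverse. *)
Definition rim_next i : 'I_n.+1 := inord (if i.+1 < k then i.+1 else 0).
Definition rim_prev i : 'I_n.+1 := inord (if i == 0 :> nat then k.-1 else i.-1).

Lemma rim_nextE i : rim_next i = (if i.+1 < k then i.+1 else 0) :> nat.
Proof. by rewrite inordK //; case: ifP => //; lia. Qed.

Lemma rim_prevE i : rim_prev i = (if i == 0 :> nat then k.-1 else i.-1) :> nat.
Proof. by rewrite inordK //; have := ltn_ord i; case: ifP => //; lia. Qed.

Lemma rim_prevK i : i < k -> rim_next (rim_prev i) = i.
Proof.
by move=> ik; apply: ord_inj; rewrite rim_nextE rim_prevE;
  case: ifP; case: ifP; lia.
Qed.

(** The second conjunct on the left discards exactly the pendant neighbours of 0. *)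
Lemma rim_neighbours i j : i < k ->
  lollipop_adj i j && ((i != 0 :> nat) || (j < k)) =
  (j == rim_next i) || (j == rim_prev i).
Proof.
move=> ik; rewrite -!val_eqE /= rim_nextE rim_prevE.
rewrite /lollipop_adj /lollipop_arc.
by have := ltn_ord j; case: ifP; case: ifP; lia.
Qed.

(** Pendant vertices have 0 as their only neighbour, so the cycle stays in the rim. It is then
    closed under [rim_next] and [rim_prev]: descending reaches 0, and climbing from 0 reaches the
    whole rim. *)
Lemma lollipop_cycle_rim (c : seq 'I_n.+1) :
  2 < size c -> ucycle lollipop_adj c -> c =i (fun i => i < k).
Proof.
move=> sc ucc.
have ck i : i \in c -> i < k.
  move=> ic; rewrite ltnNge; apply/negP=> ki.
  have nb j : j \in c -> adj lollipop i j -> j = ord0 \/ j = ord0.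
    move=> _ ij; left; apply: ord_inj; move: ij.
    by rewrite /= /lollipop_adj /lollipop_arc; have := ltn_ord j; lia.
  have /andP[_ uc] := ucc.
  have := next_neq_prev uc sc ic.
  by case: (@cycle_two_neighbours _ lollipop c sc ucc i _ _ ic nb) => -[-> ->];
    rewrite eqxx.
have rim i : i \in c -> (rim_next i \in c) && (rim_prev i \in c).
  move=> ic.
  have nb j : j \in c -> adj lollipop i j -> j = rim_next i \/ j = rim_prev i.
    move=> jc ij; have := rim_neighbours j (ck i ic).
    move: ij => /= ->; rewrite (ck _ jc) orbT.
    by case/esym/orP=> /eqP->; auto.
  by case: (@cycle_two_neighbours _ lollipop c sc ucc i _ _ ic nb) => -[<- <-];
    rewrite mem_next mem_prev ic.
have c0 : ord0 \in c.
  have [i ic] : exists i, i \in c.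
    by case: (c) sc => // x s _; exists x; rewrite mem_head.
  have [m] := ubnP (i : nat); elim: m i ic => // m IHm i ic im.
  have [i0|i0] := eqVneq (i : nat) 0.
    by have -> : ord0 = i by apply: ord_inj.
  have /andP[_ pc] := rim i ic; apply: IHm pc _.
  by rewrite rim_prevE (negbTE i0); lia.
move=> i; apply/idP/idP => [/ck//|]; rewrite unfold_in => ik.
have [m] := ubnP (i : nat); elim: m i ik => // m IHm i ik im.
have [i0|i0] := eqVneq (i : nat) 0.
  by have <- : ord0 = i by apply: ord_inj.
have := rim (rim_prev i); rewrite rim_prevK // => /(_ _)/andP[]//.
by apply: IHm; rewrite rim_prevE (negbTE i0); lia.
Qed.

(** At each vertex [c] follows the rim forwards or backwards; edges being unordered pairs, either
    direction gives the same edge set. *)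
Lemma lollipop_cycle_edges C : is_cycle lollipop C ->
  C = [set [set i; rim_next i] | i : 'I_n.+1 & i < k].
Proof.
case=> c [sc ucc ->]; have ck := lollipop_cycle_rim sc ucc.
have nb i : i < k ->
    (next c i = rim_next i /\ prev c i = rim_prev i)
    \/ (next c i = rim_prev i /\ prev c i = rim_next i).
  move=> ik; apply: (@cycle_two_neighbours _ lollipop) => //; first by rewrite ck.
  move=> j; rewrite ck unfold_in => jk ij; have := rim_neighbours j ik.
  move: ij => /= ->; rewrite jk orbT.
  by case/esym/orP=> /eqP->; auto.
have /andP[_ uc] := ucc.
apply/setP=> A; apply/imsetP/imsetP => -[i].
  rewrite ck unfold_in => ik ->.
  case: (nb i ik) => -[-> _]; first by exists i; rewrite ?inE.
  exists (rim_prev i); last by rewrite rim_prevK // finset.setUC.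
  by rewrite inE rim_prevE; case: ifP; lia.
rewrite inE => ik ->.
case: (nb i ik) => -[nE pE]; first by exists i; rewrite ?ck ?nE.
exists (prev c i); first by rewrite mem_prev ck.
by rewrite next_prev // pE finset.setUC.
Qed.

Lemma lollipop_unicyclic : unicyclic lollipop.
Proof.
pose c : seq 'I_n.+1 := map inord (iota 0 k).
have CG : is_cycle lollipop (cycle_edges c).
  have vE a : a < k -> (inord a : 'I_n.+1) = a :> nat.
    by move=> ak; rewrite inordK //; lia.
  exists c; split; rewrite ?size_map ?size_iota //; apply/andP; split; last first.
    rewrite map_inj_in_uniq ?iota_uniq // => a b; rewrite !mem_iota => ak bk.
    by move/(congr1 val); rewrite /= !vE.
  have arcs m a : a + m < k ->
      path lollipop_adj (inord a) (map inord (iota a.+1 m)).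
    elim: m a => //= m IHm a am; apply/andP; split; last by apply: IHm; lia.
    by rewrite /lollipop_adj /lollipop_arc !vE //; lia.
  have lst m a :
      last (inord a) (map inord (iota a.+1 m)) = inord (a + m) :> 'I_n.+1.
    by elim: m a => [|m IHm] a /=; rewrite ?addn0 // IHm addSnnS.
  rewrite /c -(prednK (ltnW (ltnW k2))) /= rcons_path arcs ?lst; last by lia.
  by rewrite /lollipop_adj /lollipop_arc !vE //; lia.
exists (cycle_edges c); split=> // C CG'.
by rewrite (lollipop_cycle_edges CG) (lollipop_cycle_edges CG').
Qed.

(** Stated for any [nmodType] so as to serve both for degrees in [nat] and for values of [f] in
    [R]. *)
Lemma sum_by_lollipop_kind (V : nmodType) (a b d : V) :
  (\sum_(i < n.+1) (if i == 0%N :> nat then a else if (i < k)%N then b else d)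
    = a + b *+ k.-1 + d *+ (n.+1 - k)%N)%R.
Proof.
rewrite big_ord_recl /= -addrA; congr (_ + _)%R.
(* Splitting off 0 shifts the indices by one, hence the cut at [k.-1]. *)
rewrite -(big_mkord xpredT (fun v => if v.+1 < k then b else d)).
rewrite (big_cat_nat (n := k.-1)) /=; [|lia|lia]; congr (_ + _)%R.
  rewrite (@eq_big_nat _ _ _ _ _ _ (fun=> b)) => [|i ik].
    by rewrite sumr_const_nat subn0.
  by rewrite ifT //; lia.
rewrite (@eq_big_nat _ _ _ _ _ _ (fun=> d)) => [|i ik].
  by rewrite sumr_const_nat; congr (_ *+ _)%R; lia.
by rewrite ifF //; lia.
Qed.

(** Away from 0 the neighbours are listed; the degree of 0 is what remains of the total degree
    [n.+1.*2]. *)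
Lemma lollipop_degree i : degree lollipop i =
  if i == 0 :> nat then n.+1 - k + 2 else if i < k then 2 else 1.
Proof.
have deg j : j != ord0 -> degree lollipop j = if j < k then 2 else 1.
  move=> j0; rewrite /degree; have {}j0 : (j != 0 :> nat) by [].
  case: ltnP => jk.
    have -> : [set v | lollipop j v] = [set rim_next j; rim_prev j].
      by apply/setP=> v; rewrite !inE -rim_neighbours // j0 andbT.
    rewrite cards2 -val_eqE /= rim_nextE rim_prevE (negbTE j0).
    by case: ifP; case: eqP; lia.
  have -> : [set v | lollipop j v] = [set ord0]; last by rewrite cards1.
  apply/setP=> v; rewrite !inE -val_eqE /= /lollipop_adj /lollipop_arc.
  by have := ltn_ord j; lia.
have nz j : j != ord0 -> (j == 0 :> nat) = false by move=> /negbTE.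
have [->|i0] := eqVneq i ord0; last by rewrite deg // nz.
have := unicyclic_sum_degree lollipop_unicyclic.
rewrite (bigD1 ord0) //= card_ord.
have : \sum_(j < n.+1) (if j == 0 :> nat then 0 else if j < k then 2 else 1)
    = k.-1.*2 + (n.+1 - k).
  have mulE (a m : nat) : (a *+ m)%R = a * m.
    by elim: m => [|m IHm]; rewrite ?muln0 // mulrSr IHm mulnSr.
  by have := sum_by_lollipop_kind 0%N 2%N 1%N; rewrite !mulE mul1n add0r mul2n.
rewrite (bigD1 ord0) //= add0n.
under eq_bigr => j j0 do rewrite nz // -deg //.
by move=> ->; lia.
Qed.

Lemma lollipop_deg_index (R : realType) (f : R -> R) :
  (deg_index f lollipop =
    f (n.+1 - k + 2)%N%:R + f 2 *+ k.-1 + f 1 *+ (n.+1 - k)%N)%R.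
Proof.
rewrite -sum_by_lollipop_kind; apply: eq_bigr => i _.
by rewrite lollipop_degree; case: ifP => //; case: ifP.
Qed.

End Lollipop.

(** * Convexity and the two bounds *)

Local Open Scope classical_set_scope.
Local Open Scope ring_scope.

(** Convexity at weight [(z - y) / (z - x)] on [x], multiplied by [z - x]; without division the
    inequality also covers [x = z]. *)
Lemma convex_chord (R : realType) (f : R -> R) :
  @convex_function R R^o `[1, +oo[ f ->
  forall x y z : R, 1 <= x -> x <= y -> y <= z ->
  (z - x) * f y <= (z - y) * f x + (y - x) * f z.
Proof.
move=> hf x y z x1 xy yz.
have [xz|xz] := leP z x.
  have -> : z = x by lra.
  have -> : y = x by lra.
  by rewrite !subrr !mul0r addr0.
have t0 : 0 <= (z - y) / (z - x) by apply: divr_ge0; lra.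
have t1 : (z - y) / (z - x) <= 1 by rewrite ler_pdivrMr; lra.
have := hf (Itv01 t0 t1) x z.
rewrite !inE /= !in_itv /= !andbT => /(_ x1 ltac:(lra)).
have -> : conv (Itv01 t0 t1) (x : convex_lmodType R^o) z = y.
  transitivity ((z - y) / (z - x) * x + (1 - (z - y) / (z - x)) * z) => //.
  by field; lra.
rewrite !convRE /= /unstable.onem.
rewrite -(ler_pM2l (x := z - x)); last lra.
by congr (_ <= _); field; lra.
Qed.

Lemma degree_natr_bounds (R : realType) (T : finType) (G : graph T) u :
  1 <= (degree G u)%:R :> R /\ (degree G u)%:R <= (#|T| - 1)%:R :> R.
Proof.
rewrite ler1n degree_gt0 ler_nat; split=> //.
by have := degree_lt G u; lia.
Qed.

Lemma unicyclic_sum_excess (R : realType) (T : finType) (G : graph T) :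
  unicyclic G -> \sum_u ((degree G u)%:R - 2) = 0 :> R.
Proof.
move=> uG; rewrite sumrB -natr_sum (unicyclic_sum_degree uG).
by rewrite sumr_const -[2 *+ _]mulrnA mul2n subrr.
Qed.

Lemma deg_index_lower (R : realType) (f : R -> R) (T : finType) (G : graph T) :
  @convex_function R R^o `[1, +oo[ f -> unicyclic G ->
  #|T|%:R * f 2 <= deg_index f G.
Proof.
move=> hf uG.
have support u :
    f 2 + (f 2 - f 1) * ((degree G u)%:R - 2) <= f (degree G u)%:R.
  (* Equality at degree 1; from degree 2 on, the chord from 1 to the degree is compared with [f] at
     2. *)
  have := degree_gt0 G u; case: (degree G u) => [//|[|d]] _; first lra.
  have := convex_chord hf (lexx 1) (ler1n R 2) (_ : 2 <= d.+2%:R).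
  by rewrite ler_nat => /(_ isT); lra.
apply: le_trans (ler_sum _ (fun u _ => support u)).
by rewrite big_split /= -mulr_sumr unicyclic_sum_excess // mulr0 addr0
  sumr_const mulr_natl.
Qed.

Lemma deg_index_upper (R : realType) (f : R -> R) (T : finType) (G : graph T) :
  @convex_function R R^o `[1, +oo[ f -> (3 < #|T|)%N -> unicyclic G ->
  deg_index f G <= f (#|T| - 1)%:R + 2 * f 2 + (#|T| - 3)%:R * f 1.
Proof.
move=> hf n3 uG; set n := #|T| in n3 *.
have n0 : 0 < (n - 3)%:R :> R by rewrite ltr0n subn_gt0.
have En : (n - 1)%:R = (n - 3)%:R + 2 :> R.
  by rewrite -natrD; congr (_%:R); lia.
pose m := (f (n - 1)%:R - f 2) / (n - 3)%:R.
have Em : m * (n - 3)%:R = f (n - 1)%:R - f 2 by rewrite divfK // gt_eqF.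
have slope : f 2 - f 1 <= m.
  have := convex_chord hf (lexx 1) (ler1n R 2) (_ : 2 <= (n - 1)%:R).
  rewrite ler_nat => /(_ ltac:(lia)) H.
  by rewrite -(ler_pM2r n0) Em; move: H; rewrite En; lra.
pose b u : R := (1 < degree G u)%N%:R.
(* The indicator [b] merges two cases: the bound reads [f 1] at degree 1 and [f 2 + m * (d - 2)] at
   degree d from 2 on. *)
have chord u : f (degree G u)%:R
    <= f 1 + b u * (f 2 - f 1) + m * ((degree G u)%:R - 1 - b u).
  have [] := degree_natr_bounds R G u; rewrite /b.
  case: ltnP => d2 d1 dn; last first.
    have -> : degree G u = 1%N by have := degree_gt0 G u; lia.
    by rewrite /= mul0r subrr subr0 mulr0 !addr0.
  have {}d2 : 2 <= (degree G u)%:R :> R by rewrite ler_nat.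
  have H := convex_chord hf (ler1n R 2) d2 dn.
  rewrite -(ler_pM2r n0) mulrDl (mulrAC m) Em.
  by move: H; rewrite -/n En mulr1n; lra.
apply: le_trans (ler_sum _ (fun u _ => chord u)) _.
set s := #|[set u | (1 < degree G u)%N]%SET|.
have s3 : 3 <= s%:R :> R by rewrite ler_nat; apply: card_degree_gt1.
have sb : \sum_u b u = s%:R.
  by rewrite -natr_sum /s -sum1dep_card [in RHS]big_mkcond.
have se : \sum_u ((degree G u)%:R - 1 - b u) = n%:R - s%:R.
  transitivity (\sum_u (((degree G u)%:R - 2) + (1 - b u))).
    by apply: eq_bigr => u _; ring.
  by rewrite big_split /= unicyclic_sum_excess // add0r sumrB sb sumr_const.
rewrite 2!big_split /= sumr_const -mulr_suml -mulr_sumr sb se.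
rewrite -(mulr_natl (f 1)) -/n.
have -> : n%:R = (n - 3)%:R + 3 :> R by rewrite -natrD subnK // ltnW.
(* This product is exactly the difference between the claimed bound and the summed one. *)
have : 0 <= (s%:R - 3) * (m - (f 2 - f 1)) by apply: mulr_ge0; lra.
by move: Em; lra.
Qed.

Theorem theorem3p4 (R : realType) (n : nat) (hn : (4 <= n)%N) (f : R -> R)
    (hf : @convex_function R R^o `[1, +oo[ f) :
  [/\ forall (T : finType) (G : graph T), #|T| = n -> unicyclic G ->
        n%:R * f 2 <= deg_index f G
          <= f (n - 1)%:R + 2 * f 2 + (n - 3)%:R * f 1,
      exists (T : finType) (G : graph T),
        [/\ #|T| = n, unicyclic G & deg_index f G = n%:R * f 2]
    & exists (T : finType) (G : graph T),
        [/\ #|T| = n, unicyclic G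
          & deg_index f G = f (n - 1)%:R + 2 * f 2 + (n - 3)%:R * f 1]].
Proof.
split=> [T G Tn uG||].
- by rewrite -Tn deg_index_lower // deg_index_upper // Tn.
- case: n hn => // n hn; have k2 : (2 < n.+1)%N by lia.
  (* With [k = n.+1] no vertex is pendant, and 0 has degree 2 as well. *)
  exists 'I_n.+1, (lollipop k2 (leqnn n.+1)); split; first exact: card_ord.
    exact: lollipop_unicyclic.
  rewrite lollipop_deg_index subnn mulr0n addr0 -[n.+1.-1]/n.
  by rewrite -mulr_natl mulrSr; ring.
- case: n hn => // n hn; have k3 : (3 <= n.+1)%N by lia.
  (* With [k = 3] vertex 0 is adjacent to all others, and two further vertices have degree 2. *)
  exists 'I_n.+1, (lollipop (leqnn 3) k3); split; first exact: card_ord.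
    exact: lollipop_unicyclic.
  rewrite lollipop_deg_index (_ : n.+1 - 3 + 2 = n.+1 - 1)%N; last by lia.
  by rewrite -(mulr_natl (f 2)) -(mulr_natl (f 1)).
Qed.
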